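(* Let $G$ be a finite group. The undirected power graph $\mathrm{Pow}(G)$ can be reconstructed from the cyclic subgroup lattice $\mathcal{L}_c(G)$. In particular, if $H$ is a finite group with $\mathcal{L}_c(G)\cong\mathcal{L}_c(H)$, then $\mathrm{Pow}(G)\cong\mathrm{Pow}(H)$.
   Context: $\mathcal{L}_c(G)$ is the set of cyclic subgroups of $G$ ordered by inclusion, identified with its Hasse diagram, each vertex labelled by the order of the corresponding subgroup; an isomorphism of such lattices is an order-isomorphism preserving these order labels. The power graph $\mathrm{Pow}(G)$ is the simple graph with vertex set $G$ in which distinct $x,y$ are adjacent iff one of them is a power of the other. *)

(* Defs.v *)
From HB Require Import structures.
From mathcomp Require Import all_boot all_order all_fingroup all_solvable.

Set Implicit Arguments.
Unset Strict Implicit.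
Unset Printing Implicit Defensive.

Record labelled_poset := LabelledPoset {
  lp_disp : Order.disp_t;
  lp_carrier :> finPOrderType lp_disp;
  lp_label : lp_carrier -> nat
}.

Definition lposet_iso (L M : labelled_poset) : Prop :=
  exists f : L -> M,
    [/\ bijective f,
        {mono f : x y / (x <= y)%O} &
        forall x, lp_label (f x) = lp_label x].

(* Adjacency is Prop-valued so that "is a power of" can be stated with an
   unbounded exponent. *)
Record sgraph := SGraph {
  vertex :> finType;
  adj : vertex -> vertex -> Prop;
  adj_sym : forall x y, adj x y -> adj y x;
  adj_irrefl : forall x, ~ adj x x
}.

Definition sgraph_iso (X Y : sgraph) : Prop :=
  exists f : X -> Y,
    bijective f /\ forall x y, adj x y <-> adj (f x) (f y).

Section CyclicSubgroupLattice.
Variables (gT : finGroupType) (G : {group gT}).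

Record cyclic_subgroup := CyclicSubgroup {
  csub_group :> {group gT};
  csubP : (csub_group \subset G) && cyclic csub_group
}.

HB.instance Definition _ := [isSub for csub_group].
HB.instance Definition _ := [Finite of cyclic_subgroup by <:].

Definition csub_le (C D : cyclic_subgroup) : bool := C \subset D.

Fact csub_le_refl : reflexive csub_le.
Proof. by move=> C; apply: subxx. Qed.

Fact csub_le_anti : antisymmetric csub_le.
Proof.
by move=> C D CD; apply/val_inj/val_inj/eqP; rewrite /= eqEsubset.
Qed.

Fact csub_le_trans : transitive csub_le.
Proof. by move=> D C E; apply: subset_trans. Qed.

Fact csub_display : Order.disp_t. Proof. exact: Order.Disp tt tt. Qed.

HB.instance Definition _ := Order.Le_isPOrder.Build csub_display
  cyclic_subgroup csub_le_refl csub_le_anti csub_le_trans.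

Definition cyclic_lattice : labelled_poset :=
  @LabelledPoset csub_display cyclic_subgroup (fun C => #|C|).

End CyclicSubgroupLattice.

Section PowerGraph.
Local Open Scope group_scope.
Variables (gT : finGroupType) (G : {group gT}).

Definition is_power (x y : subg_of G) : Prop := exists n : nat, x = y ^+ n.

Definition pow_adj (x y : subg_of G) : Prop :=
  x <> y /\ (is_power x y \/ is_power y x).

Fact pow_adj_sym x y : pow_adj x y -> pow_adj y x.
Proof. by case=> xy [] p; split; [exact: nesym | right | exact: nesym | left]. Qed.

Fact pow_adj_irrefl x : ~ pow_adj x x.
Proof. by case. Qed.

Definition power_graph : sgraph := SGraph pow_adj_sym pow_adj_irrefl.

End PowerGraph.

(* A reconstruction assigns a graph to every labelled poset, depends only on
   the isomorphism class of that poset, and so has access to nothing else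
   about the group; the same assignment must work for all finite groups. *)
Definition reconstructs_power_graph (F : labelled_poset -> sgraph) : Prop :=
  (forall L M : labelled_poset, lposet_iso L M -> sgraph_iso (F L) (F M)) /\
  (forall (gT : finGroupType) (G : {group gT}),
     sgraph_iso (F (cyclic_lattice G)) (power_graph G)).

(* Main.v *)
(* In a finite group, x is a power of y iff <[x]> is contained in <[y]>, so
   adjacency in the power graph only depends on the cyclic subgroups generated
   by the two elements; and a cyclic subgroup of order n is generated by
   exactly totient n elements. Blowing up each point of label n of the cyclic
   subgroup lattice into totient n vertices, and joining distinct vertices over
   comparable points, therefore gives back the power graph. *)

Require Import Defs.
From mathcomp Require Import all_boot all_order all_fingroup all_solvable.

Set Implicit Arguments.
Unset Strict Implicit.
Unset Printing Implicit Defensive.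

(** Each [x] goes to the element of the same rank in the enumeration of the [d]-fibre over [c x];
    the inequality of cardinals keeps that rank in range. *)
Lemma fiber_inj (X Y : finType) (I : eqType) (c : X -> I) (d : Y -> I) :
  (forall i, #|[pred x | c x == i]| <= #|[pred y | d y == i]|) ->
  exists2 g : X -> Y, injective g & forall x, d (g x) = c x.
Proof.
move=> le_cd.
(* [nth] needs a default value [y0] in [Y]. If [Y] is empty then so is [X], since any [x] would make
   the [d]-fibre over [c x] nonempty. *)
have [y0 _|Y0] := pickP (@predT Y); last first.
  have X0 (x : X) : False.
    have: 0 < #|[pred y | d y == c x]|.
      by apply: leq_trans (le_cd _); apply/card_gt0P; exists x; rewrite inE.
    by case/card_gt0P=> y; have:= Y0 y.
  by exists (fun x => False_rect Y (X0 x)) => x; case: (X0 x).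
pose A i := enum [pred x | c x == i]; pose B i := enum [pred y | d y == i].
pose g x := nth y0 (B (c x)) (index x (A (c x))).
have inA x : x \in A (c x) by rewrite mem_enum inE.
have lt_B x : index x (A (c x)) < size (B (c x)).
  by rewrite -cardE (leq_trans _ (le_cd _)) // cardE index_mem.
have dg x : d (g x) = c x.
  by apply/eqP; have:= mem_nth y0 (lt_B x); rewrite mem_enum inE.
exists g => // x x' eq_g.
have eq_c : c x = c x' by rewrite -!dg eq_g.
have lt_B' : index x' (A (c x)) < size (B (c x)) by rewrite eq_c.
move/eqP: eq_g; rewrite /g -eq_c nth_uniq ?enum_uniq // => /eqP.
by apply: index_inj; rewrite ?inA // eq_c.
Qed.

Lemma fiber_bij (X Y : finType) (I : eqType) (c : X -> I) (d : Y -> I) :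
  (forall i, #|[pred x | c x == i]| = #|[pred y | d y == i]|) ->
  exists2 g : X -> Y, bijective g & forall x, d (g x) = c x.
Proof.
move=> eq_cd.
have [|g g_inj dg] := @fiber_inj X Y I c d; first by move=> i; rewrite eq_cd.
have [|h h_inj _] := @fiber_inj Y X I d c; first by move=> i; rewrite eq_cd.
by exists g => //; apply: inj_card_bij (leq_card h h_inj).
Qed.

Lemma sgraph_iso_sym X Y : sgraph_iso X Y -> sgraph_iso Y X.
Proof.
case=> f [[g fK gK] adjf]; exists g; split; first by exists f.
by move=> x y; rewrite -{1}(gK x) -{1}(gK y); apply: iff_sym; apply: adjf.
Qed.

Lemma sgraph_iso_trans Y X Z :
  sgraph_iso X Y -> sgraph_iso Y Z -> sgraph_iso X Z.
Proof.
case=> f [f_bij adjf] [g [g_bij adjg]].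
exists (g \o f); split; first exact: bij_comp.
by move=> x y; apply: iff_trans (adjf x y) (adjg _ _).
Qed.

(** The common shape of the blowup and of the power graph: up to isomorphism, such a graph is
    determined by the order on [L] and the fibre sizes of [c]. *)
Definition comparability_over (X : sgraph) (L : labelled_poset) (c : X -> L) :=
  forall x y : X, adj x y <-> x <> y /\ ((c x <= c y)%O \/ (c y <= c x)%O).

(** Adjacency sees only distinctness and the points below the vertices, so any bijection that
    carries fibres to fibres along [f] is a graph isomorphism. *)
Lemma comparability_over_iso (X Y : sgraph) (L M : labelled_poset)
    (c : X -> L) (d : Y -> M) (f : L -> M) :
    bijective f -> {mono f : x y / (x <= y)%O} ->
    comparability_over c -> comparability_over d ->
    (forall l, #|[pred x | c x == l]| = #|[pred y | d y == f l]|) ->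
  sgraph_iso X Y.
Proof.
case=> f' fK f'K f_mono cX dY card_cd.
have [|g g_bij dg] := @fiber_bij X Y M (f \o c) d.
  move=> m; rewrite -{2}(f'K m) -card_cd; apply: eq_card => x.
  by rewrite !inE /= (can2_eq fK f'K).
exists g; split=> // x y.
apply: iff_trans (cX x y) (iff_trans _ (iff_sym (dY _ _))).
rewrite !dg /= !f_mono; split=> -[xy cmp]; split=> //; last by move=> /(congr1 g).
by move/(bij_inj g_bij).
Qed.

Section Blowup.
Variable L : labelled_poset.

Definition blowup_vertex : finType := {l : L & 'I_(totient (lp_label l))}.

Definition blowup_adj (u v : blowup_vertex) : Prop :=
  u <> v /\ ((tag u <= tag v)%O \/ (tag v <= tag u)%O).

Lemma blowup_adj_sym u v : blowup_adj u v -> blowup_adj v u.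
Proof. by case=> uv cmp; split; [exact: nesym | exact/or_comm]. Qed.

Lemma blowup_adj_irrefl u : ~ blowup_adj u u.
Proof. by case. Qed.

Definition blowup : sgraph := SGraph blowup_adj_sym blowup_adj_irrefl.

Definition blowup_tag (u : blowup) : L := tag (u : blowup_vertex).

Lemma blowup_over : comparability_over blowup_tag.
Proof. by []. Qed.

Lemma card_blowup_fiber l :
  #|[pred u | blowup_tag u == l]| = totient (lp_label l).
Proof.
pose T (l : L) := 'I_(totient (lp_label l)).
have T_inj : injective (fun i : T l => Tagged T i : blowup_vertex).
  by move=> i j /eqP; rewrite eq_Tagged => /eqP.
rewrite -[RHS]card_ord -(card_image T_inj).
apply: eq_card => -[k i]; rewrite !inE; apply/eqP/imageP => [/= eq_kl | [j _ ->]//].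
(* The type of [i] depends on [k]; eliminating [k = l] makes [i] itself an index over [l]. *)
by rewrite /blowup_tag /= in eq_kl; case: l / eq_kl {T_inj}; exists i.
Qed.

End Blowup.

Section PowerGraphOver.
Variables (gT : finGroupType) (G : {group gT}).

Lemma gen_csub_subproof (x : subg_of G) :
  (<[sgval x]>%G \subset G) && cyclic <[sgval x]>%G.
Proof. by rewrite cycle_subG subgP cycle_cyclic. Qed.

Definition gen_csub (x : power_graph G) : cyclic_lattice G :=
  CyclicSubgroup (gen_csub_subproof x).

Lemma is_powerP (x y : subg_of G) :
  is_power x y <-> (gen_csub x <= gen_csub y)%O.
Proof.
(* The order unfolds to inclusion of cyclic groups, which amounts to membership of the generator
   [sgval x] in the larger one. *)
rewrite [(_ <= _)%O]cycle_subG.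
split=> [[n ->]|/cycleP[n xyn]]; first by rewrite morphX ?inE ?mem_cycle.
by exists n; apply: val_inj; rewrite /= xyn -morphX ?inE.
Qed.

Lemma power_graph_over : comparability_over gen_csub.
Proof.
move=> x y; split=> -[xy cmp]; split=> //.
  by case: cmp => /is_powerP; [left | right].
by case: cmp => /is_powerP; [left | right].
Qed.

(** The injection [sgval] maps the fibre over [C] onto the generators of [C] in [gT], which
    [totient_gen] counts. *)
Lemma card_gen_csub_fiber (C : cyclic_lattice G) :
  #|[pred x | gen_csub x == C]| = totient (lp_label C).
Proof.
have /andP[sCG /cyclicP[z defC]] := csubP C.
rewrite /lp_label /= defC -orderE totient_gen -(card_image (@subg_inj _ G)).
apply: eq_card => y; rewrite !inE /generator -defC.
have genE x : (gen_csub x == C) = (C == <[sgval x]>%g :> {set gT}).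
  by rewrite eq_sym.
apply/imageP/idP => [[x]|defCy]; first by rewrite inE genE => ? ->.
(* Surjectivity: a generator of [C] lies in [G], hence comes from an element of [subg_of G]. *)
have Gy : y \in G by rewrite (subsetP sCG) // (eqP defCy) cycle_id.
by exists (subg G y); rewrite ?inE ?genE subgK.
Qed.

End PowerGraphOver.

Theorem theorem4 :
  (exists F : labelled_poset -> sgraph, reconstructs_power_graph F) /\
  (forall (gT hT : finGroupType) (G : {group gT}) (H : {group hT}),
     lposet_iso (cyclic_lattice G) (cyclic_lattice H) ->
     sgraph_iso (power_graph G) (power_graph H)).
Proof.
have blowup_iso L M : lposet_iso L M -> sgraph_iso (blowup L) (blowup M).
  case=> f [f_bij f_mono f_label].
  apply: (comparability_over_iso f_bij f_mono
            (@blowup_over L) (@blowup_over M)) => l.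
  by rewrite !card_blowup_fiber f_label.
have blowup_pow (gT : finGroupType) (G : {group gT}) :
    sgraph_iso (blowup (cyclic_lattice G)) (power_graph G).
  (* Both graphs lie over the same lattice, so the identity serves as the order isomorphism and only
     fibre sizes remain to be compared. *)
  have id_bij : bijective (@id (cyclic_lattice G)) by exists id.
  apply: (comparability_over_iso id_bij _
            (@blowup_over _) (@power_graph_over _ G)) => // C.
  by rewrite card_blowup_fiber card_gen_csub_fiber.
split; first by exists blowup.
move=> gT hT G H /blowup_iso isoGH.
apply: sgraph_iso_trans (sgraph_iso_sym (blowup_pow _ G)) _.
exact: sgraph_iso_trans isoGH (blowup_pow _ H).
Qed.
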